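(* Let $z_1,z_2,z_3\in\mathbb T=\{z\in\mathbb C:|z|=1\}$ be the vertices of a triangle circumscribed about a central conic with foci $a_1,a_2\in\mathbb C$, and let $\lambda=z_1z_2z_3\in\mathbb T$. Then each $z\in\{z_1,z_2,z_3\}$ satisfies $$z\,\frac{z-a_1}{1-\overline{a_1}z}\,\frac{z-a_2}{1-\overline{a_2}z}=\lambda.$$
   Context: The plane is identified with $\mathbb C$. A central conic is an ellipse or a hyperbola. A triangle is circumscribed about a conic if each of its three side lines is tangent to the conic (the point of tangency need not lie on the side segment). *)

(* Defs.v *)
From Stdlib Require Import Reals.
From Coquelicot Require Import Coquelicot.

Local Open Scope C_scope.

Definition ellipse (a1 a2 : C) (r : R) (p : C) : Prop :=
  (Cmod (p - a1) + Cmod (p - a2))%R = r.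

Definition hyperbola (a1 a2 : C) (r : R) (p : C) : Prop :=
  Rabs (Cmod (p - a1) - Cmod (p - a2)) = r.

(* The bounds on r exclude the degenerate loci (points, segments, rays,
   the perpendicular bisector).  A circle is the ellipse
   with a1 = a2. *)
Definition is_central_conic (a1 a2 : C) (S : C -> Prop) : Prop :=
  (exists r : R, (Cmod (a1 - a2) < r)%R /\
     forall p, S p <-> ellipse a1 a2 r p) \/
  (exists r : R, (0 < r < Cmod (a1 - a2))%R /\
     forall p, S p <-> hyperbola a1 a2 r p).

Definition line_dir (p v : C) (q : C) : Prop :=
  exists t : R, q = p + RtoC t * v.

Definition line_through (z w : C) : C -> Prop := line_dir z (w - z).

(* v is the velocity at p of a curve running inside S near p. *)
Definition tangent_vector (S : C -> Prop) (p v : C) : Prop :=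
  exists g : R -> C,
    g 0%R = p /\
    locally 0%R (fun t : R => S (g t)) /\
    is_derive (K := R_AbsRing) (V := C_R_NormedModule) g 0%R v.

(* The point of tangency p is a point of the plane, so an asymptote of a
   hyperbola is not counted as a tangent line. *)
Definition tangent_line (S L : C -> Prop) : Prop :=
  exists p v : C,
    S p /\ v <> 0 /\ tangent_vector S p v /\
    forall q, L q <-> line_dir p v q.

Definition is_triangle (z1 z2 z3 : C) : Prop :=
  z1 <> z2 /\ ~ line_through z1 z2 z3.

Definition circumscribed (S : C -> Prop) (z1 z2 z3 : C) : Prop :=
  tangent_line S (line_through z1 z2) /\
  tangent_line S (line_through z2 z3) /\
  tangent_line S (line_through z3 z1).

(* Main.v *)
Require Import Defs.
From Stdlib Require Import Reals Lra.
From Coquelicot Require Import Coquelicot.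

(** Write [x × y] for the real cross product.  If a line with direction [u]
    through [z] is tangent to the conic with foci [a1], [a2] and parameter [r],
    then the signed distances from the foci to it have the constant product
    [(r^2 - |a1 - a2|^2) / 4], whether the conic is an ellipse or a hyperbola.
    Comparing the two tangents from a vertex [z], with directions [u] and [v],
    yields the isogonal property: [(z - a1) (z - a2) / (u v)] is real.  When
    [z], [z + u], [z + v] lie on the unit circle, this quotient equals its
    conjugate exactly when the stated equation holds at [z]. *)

Local Open Scope R_scope.

Definition cross (x y : C) : R := fst x * snd y - snd x * fst y.

Definition normsq (x : C) : R := fst x ^ 2 + snd x ^ 2.

Lemma Cmod_sqr (x : C) : Cmod x ^ 2 = normsq x.
Proof.
  unfold Cmod, normsq. apply pow2_sqrt. nra.
Qed.

Lemma is_derive_fst (g : R -> C) (t : R) (v : C) :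
  is_derive (K := R_AbsRing) (V := C_R_NormedModule) g t v ->
  is_derive (fun t => fst (g t)) t (fst v).
Proof.
  intros H.
  apply (filterdiff_comp' g (fst : C_R_NormedModule -> R_NormedModule) t _ fst H).
  apply filterdiff_linear, (is_linear_fst (U:=R_NormedModule) (V:=R_NormedModule)).
Qed.

Lemma is_derive_snd (g : R -> C) (t : R) (v : C) :
  is_derive (K := R_AbsRing) (V := C_R_NormedModule) g t v ->
  is_derive (fun t => snd (g t)) t (snd v).
Proof.
  intros H.
  apply (filterdiff_comp' g (snd : C_R_NormedModule -> R_NormedModule) t _ snd H).
  apply filterdiff_linear, (is_linear_snd (U:=R_NormedModule) (V:=R_NormedModule)).
Qed.

(** * Tangents to a central conic and the product of focal distances *)

(* Squaring away the square roots gives one equation for both kinds of conic. *)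
Lemma central_conic_equation (a1 a2 : C) (S : C -> Prop) :
  is_central_conic a1 a2 S ->
  exists r, r <> 0 /\ r ^ 2 <> normsq (a1 - a2) /\
    forall p, S p ->
      (normsq (p - a1) + normsq (p - a2) - r ^ 2) ^ 2
        = 4 * normsq (p - a1) * normsq (p - a2).
Proof.
  intros [[r [Hr HS]]|[r [Hr HS]]]; exists r.
  all: pose proof (Cmod_ge_0 (a1 - a2)); rewrite <- (Cmod_sqr (a1 - a2)).
  all: split; [lra|split; [nra|]]; intros p Hp; apply HS in Hp.
  all: rewrite <- !Cmod_sqr.
  - red in Hp. rewrite <- Hp. ring.
  - red in Hp. rewrite <- Hp, pow2_abs. ring.
Qed.

(** The quartic form of the conic equation vanishes along the curve near 0, so its derivative there
    is zero. By the chain rule that derivative is four times the difference of the two sides. *)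
Lemma tangency_equation (a1 a2 : C) (r : R) (S : C -> Prop) (p v : C) :
  (forall q, S q ->
     (normsq (q - a1) + normsq (q - a2) - r ^ 2) ^ 2
       = 4 * normsq (q - a1) * normsq (q - a2)) ->
  tangent_vector S p v ->
  let dot x := fst x * fst v + snd x * snd v in
  (normsq (p - a1) + normsq (p - a2) - r ^ 2) * (dot (p - a1)%C + dot (p - a2)%C)
    = 2 * (dot (p - a1)%C * normsq (p - a2) + dot (p - a2)%C * normsq (p - a1)).
Proof.
  intros HS [g [Hg0 [Hloc Hder]]] dot.
  pose proof (is_derive_fst _ _ _ Hder) as Hx.
  pose proof (is_derive_snd _ _ _ Hder) as Hy.
  set (F := fun t => (normsq (g t - a1) + normsq (g t - a2) - r ^ 2) ^ 2
       - 4 * normsq (g t - a1) * normsq (g t - a2)).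
  assert (H0 : is_derive F 0 0).
  { apply (is_derive_ext_loc (fun _ => 0)).
    - revert Hloc. apply filter_imp. intros t Ht. symmetry. apply Rminus_diag_eq, HS, Ht.
    - apply (is_derive_const (V := R_NormedModule) 0). }
  assert (H1 : is_derive F 0
    (4 * (normsq (p - a1) + normsq (p - a2) - r ^ 2) * (dot (p - a1)%C + dot (p - a2)%C)
     - 8 * (dot (p - a1)%C * normsq (p - a2) + dot (p - a2)%C * normsq (p - a1)))).
  { rewrite <- Hg0. unfold F, dot, normsq. simpl.
    set (gx := fun t => fst (g t)). set (gy := fun t => snd (g t)).
    change (is_derive gx 0 (fst v)) in Hx. change (is_derive gy 0 (snd v)) in Hy.
    change (fst (g 0)) with (gx 0). change (snd (g 0)) with (gy 0).
    apply (is_derive_ext (fun t : R =>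
      ((gx t - fst a1) ^ 2 + (gy t - snd a1) ^ 2
        + ((gx t - fst a2) ^ 2 + (gy t - snd a2) ^ 2) - r ^ 2) ^ 2
      - 4 * ((gx t - fst a1) ^ 2 + (gy t - snd a1) ^ 2)
        * ((gx t - fst a2) ^ 2 + (gy t - snd a2) ^ 2))).
    { intros t. unfold gx, gy. simpl. ring. }
    auto_derive.
    - repeat split; eexists; eassumption.
    - rewrite (is_derive_unique (fun x : R => gx x) _ _ Hx).
      rewrite (is_derive_unique (fun x : R => gy x) _ _ Hy). ring. }
  apply is_derive_unique in H0. apply is_derive_unique in H1. lra.
Qed.

(** Here [x] and [y] run from the foci to the point of tangency and [v] is the tangent direction. By
    the reflection property, the mirror image of [y] in the line of [v] is parallel to [x], which
    fixes the product of the cross products. *)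
Lemma focal_product (x y v : C) (r : R) :
  let dot x := fst x * fst v + snd x * snd v in
  r <> 0 -> r ^ 2 <> normsq (x - y) ->
  (normsq x + normsq y - r ^ 2) ^ 2 = 4 * normsq x * normsq y ->
  (normsq x + normsq y - r ^ 2) * (dot x + dot y)
    = 2 * (dot x * normsq y + dot y * normsq x) ->
  4 * cross x v * cross y v = (r ^ 2 - normsq (x - y)) * normsq v.
Proof.
  intros dot Hr Hne HT Ht.
  set (A := normsq x) in *. set (B := normsq y) in *. set (N := normsq v).
  (* [T] is minus the product of the focal distances for an ellipse, and plus that product for a
     hyperbola. *)
  set (T := (A + B - r ^ 2) / 2).
  set (s1 := cross x v). set (s2 := cross y v).
  set (al := dot x) in *. set (be := dot y) in *.
  assert (hT : T ^ 2 = A * B) by (unfold T; lra).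
  assert (ht : T * (al + be) = al * B + be * A) by (unfold T; lra).
  assert (hA : al ^ 2 + s1 ^ 2 = A * N)
    by (unfold al, s1, A, N, dot, cross, normsq; ring).
  assert (hB : be ^ 2 + s2 ^ 2 = B * N)
    by (unfold be, s2, B, N, dot, cross, normsq; ring).
  assert (hxy : normsq (x - y) * N = A * N + B * N - 2 * (al * be + s1 * s2))
    by (unfold al, be, s1, s2, A, B, N, dot, cross, normsq; simpl; ring).
  assert (hneg : A + B - 2 * T <> 0) by (unfold T; intros E; apply Hr; nra).
  assert (hr : r ^ 2 = A + B - 2 * T) by (unfold T; lra).
  rewrite hr in Hne |- *. clearbody T A B N s1 s2 al be. clear Ht HT hr Hr dot.
  destruct (Req_dec N 0) as [N0|N0].
  { assert (s1 = 0) by nra. subst s1 N. ring. }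
  (* The right side is [N] times the dot product of [x] and [y], so equality would give
     [r ^ 2 = normsq (x - y)]. *)
  assert (hne : T * N <> al * be + s1 * s2).
  { intros E. apply Hne. apply (Rmult_eq_reg_r N); [lra|assumption]. }
  assert (T0 : T <> 0).
  { intros ->. apply hne. assert (E : A * B = 0) by lra.
    apply Rmult_integral in E. destruct E; subst.
    - assert (al = 0) by nra. assert (s1 = 0) by nra. subst. ring.
    - assert (be = 0) by nra. assert (s2 = 0) by nra. subst. ring. }
  assert (nAB : A <> 0 /\ B <> 0) by (split; intros ->; apply T0; nra).
  destruct nAB as [A0 B0].
  (* Multiplied by [T], the tangency equation factors as [(T - A) * (T * be - B * al) = 0] since
     [T ^ 2 = A * B]. The case [T = A] forces [T = B], hence [r = 0]. *)
  assert (h1 : T * be = B * al).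
  { apply (Rmult_eq_reg_l (T - A)).
    - transitivity (T * (be * (T - A))); [ring|].
      replace (be * (T - A)) with (al * (B - T)) by lra.
      transitivity (T * B * al - T ^ 2 * al); [ring|]. rewrite hT. ring.
    - intros E. assert (A = T) by lra. subst A. apply hneg.
      assert (T = B) by (apply (Rmult_eq_reg_l T); lra). lra. }
  assert (h2 : T * al = A * be).
  { apply (Rmult_eq_reg_l T); [|assumption].
    transitivity (T ^ 2 * al); [ring|]. rewrite hT, Rmult_assoc, <- h1. ring. }
  assert (h3 : (s1 * T - A * s2) * (s1 * T + A * s2) = 0).
  { transitivity (T ^ 2 * s1 ^ 2 - A ^ 2 * s2 ^ 2); [ring|]. rewrite hT.
    replace (s1 ^ 2) with (A * N - al ^ 2) by lra.
    replace (s2 ^ 2) with (B * N - be ^ 2) by lra.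
    transitivity (A * (A * be * be - B * al * al)); [ring|].
    rewrite <- h1, <- h2. ring. }
  (* In complex terms [h1], [h2] and [h3] leave two cases: either
     [T x = A y], so that [x] and [y] are parallel and [hne] is
     violated, or [T x] is [A] times the reflection of [y] in the line of [v]. *)
  enough (al * be - s1 * s2 = T * N) by lra.
  apply (Rmult_eq_reg_l T); [|assumption].
  apply Rmult_integral in h3. destruct h3 as [h3|h3].
  - exfalso. apply hne. apply (Rmult_eq_reg_l T); [|assumption].
    transitivity (A * (be ^ 2 + s2 ^ 2)).
    + rewrite hB. transitivity (T ^ 2 * N); [ring|]. rewrite hT. ring.
    + transitivity (T * al * be + A * s2 * s2); [rewrite h2; ring|].
      replace (A * s2) with (s1 * T) by lra. ring.
  - transitivity (A * (be ^ 2 + s2 ^ 2)).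
    + transitivity (T * al * be - s1 * T * s2); [ring|].
      replace (s1 * T) with (- (A * s2)) by lra. rewrite h2. ring.
    + rewrite hB. transitivity (A * B * N); [ring|]. rewrite <- hT. ring.
Qed.

(** * From focal products to the equation at a vertex *)

Local Open Scope C_scope.

(** The constant [k] depends on the conic alone: it is the squared semi-minor axis of an ellipse, or
    minus the squared semi-conjugate axis of a hyperbola. *)
Lemma tangent_focal_product (a1 a2 : C) (S : C -> Prop) :
  is_central_conic a1 a2 S ->
  exists k : R, k <> 0%R /\
    forall z w, tangent_line S (line_through z w) ->
      (cross (z - a1) (w - z) * cross (z - a2) (w - z) = k * normsq (w - z))%R.
Proof.
  intros HS. destruct (central_conic_equation _ _ _ HS) as [r [Hr [Hne HF]]].
  exists ((r ^ 2 - normsq (a1 - a2)) / 4)%R. split; [lra|].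
  intros z w [p [v [Hp [_ [Hv HL]]]]].
  pose proof (tangency_equation _ _ _ _ _ _ HF Hv) as Ht.
  assert (E : normsq ((p - a1) - (p - a2)) = normsq (a1 - a2))
    by (unfold normsq; simpl; ring).
  assert (H := focal_product (p - a1) (p - a2) v r Hr).
  rewrite E in H. specialize (H Hne (HF _ Hp) Ht). clear - H HL.
  assert (Hz : line_dir p v z).
  { apply HL. exists 0%R. ring. }
  assert (Hw : line_dir p v w).
  { apply HL. exists 1%R. ring. }
  destruct Hz as [t ->], Hw as [s ->].
  revert H. unfold cross, normsq. simpl. intros H.
  (* Sliding the base point along the line does not change the cross products with [v], and [w - z]
     is [(s - t)] times [v], so both sides scale by [(s - t) ^ 2]. *)
  match type of H with ?A = ?B =>
    transitivity ((s - t) ^ 2 * A / 4)%R; [field|rewrite H; field] end.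
Qed.

(** Eliminating [k] leaves a polynomial identity; in polar form it is the factorization of a
    difference of two cosines. *)
Lemma cross_product_isogonal (p q u v : C) (k : R) :
  cross u v <> 0%R ->
  (cross p u * cross q u = k * normsq u)%R ->
  (cross p v * cross q v = k * normsq v)%R ->
  p * q * Cconj (u * v) = Cconj (p * q) * (u * v).
Proof.
  intros Hc Hu Hv.
  assert (H : (cross u v * Im (p * q * Cconj (u * v)) = 0)%R).
  { transitivity (normsq v * (cross p u * cross q u)
                  - normsq u * (cross p v * cross q v))%R.
    - unfold cross, normsq, Im. simpl. ring.
    - rewrite Hu, Hv. ring. }
  apply Rmult_integral in H. destruct H as [H|H]; [contradiction|].
  assert (E : Cconj (p * q) * (u * v) = Cconj (p * q * Cconj (u * v))).
  { rewrite (Cmult_conj (p * q)), Cconj_conj. reflexivity. }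
  rewrite E. apply injective_projections; unfold Im in H; simpl in *; lra.
Qed.

Lemma unit_Cconj (z : C) : Cmod z = 1%R -> Cconj z = / z.
Proof.
  intros H. assert (z <> 0) by (intros ->; rewrite Cmod_0 in H; lra).
  assert (E : z * Cconj z = 1) by (rewrite <- Cmod2_conj, H; f_equal; ring).
  replace (Cconj z) with (z * Cconj z / z) by (field; assumption).
  rewrite E. field. assumption.
Qed.

(* A tangent from [z] misses the foci because the focal product [k] is nonzero. *)
Lemma vertex_equation (z w y a1 a2 : C) (k : R) :
  Cmod z = 1%R -> Cmod w = 1%R -> Cmod y = 1%R -> k <> 0%R ->
  cross (w - z) (y - z) <> 0%R ->
  (cross (z - a1) (w - z) * cross (z - a2) (w - z) = k * normsq (w - z))%R ->
  (cross (z - a1) (y - z) * cross (z - a2) (y - z) = k * normsq (y - z))%R ->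
  z * ((z - a1) / (1 - Cconj a1 * z)) * ((z - a2) / (1 - Cconj a2 * z))
    = z * w * y.
Proof.
  intros hz hw hy hk hc H1 H2.
  assert (nz : forall x : C, Cmod x = 1%R -> x <> 0).
  { intros x hx ->. rewrite Cmod_0 in hx. lra. }
  assert (Hiso := cross_product_isogonal _ _ _ _ _ hc H1 H2).
  assert (hwz : w - z <> 0).
  { intros E. apply hc. rewrite E. unfold cross. simpl. ring. }
  assert (hyz : y - z <> 0).
  { intros E. apply hc. rewrite E. unfold cross. simpl. ring. }
  assert (hN : (k * normsq (w - z) <> 0)%R).
  { apply Rmult_integral_contrapositive_currified; [assumption|].
    rewrite <- Cmod_sqr. apply pow_nonzero. intros E.
    apply hwz, Cmod_eq_0, E. }
  assert (n1 : z - a1 <> 0).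
  { intros E. apply hN. rewrite <- H1, E. unfold cross. simpl. ring. }
  assert (n2 : z - a2 <> 0).
  { intros E. apply hN. rewrite <- H1, E. unfold cross. simpl. ring. }
  assert (c0 : forall x : C, x <> 0 -> Cconj x <> 0).
  { intros x hx E. apply hx. rewrite <- (Cconj_conj x), E.
    apply injective_projections; simpl; ring. }
  (* On the unit circle 1 is [z * Cconj z]. *)
  assert (d : forall a, 1 - Cconj a * z = z * Cconj (z - a)).
  { intros a. rewrite Cminus_conj, (unit_Cconj z hz). field. auto. }
  rewrite !d.
  rewrite (Cmult_conj (w - z)), !Cminus_conj, !unit_Cconj, Cmult_conj in Hiso
    by assumption.
  (* Conjugation inverts unit numbers, so the conjugate of [(w - z) * (y - z)] is that product
     divided by [z * z * w * y]; the isogonal relation then gives the claim. *)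
  assert (E : (z - a1) * (z - a2)
              = Cconj (z - a1) * Cconj (z - a2) * (z * z * w * y)).
  { transitivity ((z - a1) * (z - a2) * ((/ w - / z) * (/ y - / z))
                  * (z * z * w * y) / ((w - z) * (y - z))).
    - field. auto 6.
    - rewrite Hiso. field. auto. }
  transitivity ((z - a1) * (z - a2) / (z * Cconj (z - a1) * Cconj (z - a2))).
  - field. auto.
  - rewrite E. field. auto.
Qed.

Lemma cross_neq0 (z w y : C) :
  z <> w -> ~ line_through z w y -> cross (w - z) (y - z) <> 0%R.
Proof.
  intros hzw hy E. apply hy.
  assert (hN : normsq (w - z) <> 0%R).
  { rewrite <- Cmod_sqr. apply pow_nonzero. intros E'.
    apply (Cminus_eq_contra w z); [auto|]. apply Cmod_eq_0, E'. }
  set (u := w - z) in *. set (d := y - z) in *.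
  (* This is the coefficient of the orthogonal projection of [d] onto [u], which is [d] itself when
     the cross product vanishes. *)
  exists ((fst u * fst d + snd u * snd d) / normsq u)%R.
  replace y with (z + d) by (unfold d; ring). fold u.
  apply injective_projections; apply (Rmult_eq_reg_l (normsq u)); try assumption.
  - transitivity (fst z * normsq u + (fst u * fst d + snd u * snd d) * fst u
                  - snd u * cross u d)%R.
    + unfold cross, normsq. simpl. ring.
    + rewrite E. simpl. field. assumption.
  - transitivity (snd z * normsq u + (fst u * fst d + snd u * snd d) * snd u
                  + fst u * cross u d)%R.
    + unfold cross, normsq. simpl. ring.
    + rewrite E. simpl. field. assumption.
Qed.

Theorem corollary3p1 (z1 z2 z3 a1 a2 lambda : C) (S : C -> Prop)
  (hz1 : Cmod z1 = 1%R) (hz2 : Cmod z2 = 1%R) (hz3 : Cmod z3 = 1%R)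
  (htri : is_triangle z1 z2 z3)
  (hconic : is_central_conic a1 a2 S)
  (hcirc : circumscribed S z1 z2 z3)
  (hlambda : lambda = z1 * z2 * z3) :
  forall z : C, z = z1 \/ z = z2 \/ z = z3 ->
    z * ((z - a1) / (1 - Cconj a1 * z)) * ((z - a2) / (1 - Cconj a2 * z))
      = lambda.
Proof.
  destruct htri as [n12 htri], hcirc as [T12 [T23 T31]].
  destruct (tangent_focal_product _ _ _ hconic) as [k [hk HT]].
  assert (hc := cross_neq0 _ _ _ n12 htri).
  apply HT in T12.
  apply HT in T23.
  apply HT in T31.
  intros z Hz. subst lambda. destruct Hz as [-> | [-> | ->]].
  - apply (vertex_equation z1 z2 z3 a1 a2 k); auto.
    (* Reversing a side flips the sign of both cross products, so their product is unchanged. *)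
    revert T31. unfold cross, normsq. simpl. intros H. lra.
  - replace (z1 * z2 * z3) with (z2 * z3 * z1) by ring.
    apply (vertex_equation z2 z3 z1 a1 a2 k); auto.
    + revert hc. unfold cross. simpl. lra.
    + revert T12. unfold cross, normsq. simpl. intros H. lra.
  - replace (z1 * z2 * z3) with (z3 * z1 * z2) by ring.
    apply (vertex_equation z3 z1 z2 a1 a2 k); auto.
    + revert hc. unfold cross. simpl. lra.
    + revert T23. unfold cross, normsq. simpl. intros H. lra.
Qed.
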